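(* Let $\mathbb{F}\in\{\mathbb{R},\mathbb{C}\}$, let $\mathcal{X}=\mathrm{span}\{X_1,\dots,X_k\}\subset\mathbb{F}^{n\times n}$ be a $k$-dimensional subspace, let $Y\in\mathbb{F}^{n\times n}\setminus\mathcal{X}$, and let $X_*\in\mathcal{X}$ be a spectral approximation of $Y$ from $\mathcal{X}$, i.e., $\|Y-X_*\|_2=\min_{X\in\mathcal{X}}\|Y-X\|_2$. Define $$A_i=(Y-X_* )^HX_i,\ i=1,\dots,k,\qquad A_Y=(Y-X_* )^HY,\qquad \varrho=\|Y-X_*\|_2^2,$$ and let $e_1\in\mathbb{R}^{k+1}$ be the first column of the identity matrix. Then the following are equivalent: (1) $\displaystyle\max_{v\in\mathbb{F}^n,\ \|v\|_2=1}\ \min_{X\in\mathcal{X}}\|(Y-X)v\|_2=\min_{X\in\mathcal{X}}\ \max_{v\in\mathbb{F}^n,\ \|v\|_2=1}\|(Y-X)v\|_2.$ (2) $0\in\mathscr{F}(A_1,\dots,A_k;\Sigma_{Y-X_*})$. (3) $\varrho\,e_1\in\mathscr{F}(A_Y,A_1,\dots,A_k)$.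
   Context: $\|v\|_2=(v^Hv)^{1/2}$ is the Euclidean norm on $\mathbb{F}^n$ and $\|A\|_2=\max_{v\in\mathbb{F}^n,\,\|v\|_2=1}\|Av\|_2$ is the spectral norm on $\mathbb{F}^{n\times n}$; $^H$ denotes the conjugate transpose. For an integer $m\ge 1$, matrices $B_1,\dots,B_m\in\mathbb{F}^{n\times n}$ and a subspace $\mathcal{S}\subseteq\mathbb{F}^n$ (over the same field $\mathbb{F}$), the $m$-dimensional field of the $m$ matrices $B_1,\dots,B_m$ restricted to $\mathcal{S}$ is $$\mathscr{F}(B_1,\dots,B_m;\mathcal{S})=\left\{[v^HB_1v,\dots,v^HB_mv]^T:\ v\in\mathcal{S},\ \|v\|_2=1\right\}\subset\mathbb{F}^m,$$ and $\mathscr{F}(B_1,\dots,B_m)=\mathscr{F}(B_1,\dots,B_m;\mathbb{F}^n)$. $\Sigma_{Y-X_*}\subseteq\mathbb{F}^n$ denotes the span of the maximal right singular vectors of $Y-X_*$, i.e., of the right singular vectors corresponding to the maximal singular value $\|Y-X_*\|_2$ of $Y-X_*$. *)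

(* Defs.v *)
From HB Require Import structures.
From mathcomp Require Import all_boot all_order all_algebra.
From mathcomp Require Import all_classical all_reals.
From mathcomp Require Import complex.
Set Implicit Arguments.
Unset Strict Implicit.
Unset Printing Implicit Defensive.
Import Order.TTheory GRing.Theory Num.Theory.
Local Open Scope classical_set_scope.
Local Open Scope ring_scope.

(* A scalar field over R together with its conjugation, its real part and the
   inclusion of R.  Only the two instances [real_scalars] and
   [complex_scalars] are meant to be used, so no axioms are attached. *)
Record scalar_field (R : realType) := ScalarField {
  scalar :> fieldType;
  sconj : scalar -> scalar;
  sre : scalar -> R;
  sreal : R -> scalar }.

Definition real_scalars (R : realType) : scalar_field R :=
  @ScalarField R R id id id.

Definition complex_scalars (R : realType) : scalar_field R :=
  @ScalarField R (complex R : fieldType) (@conjc R) (@complex.Re R)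
    (fun x => Complex x 0).

Section Extrema.
Context {R : realType}.

Definition is_max (S : set R) (m : R) : Prop := S m /\ ubound S m.
Definition is_min (S : set R) (m : R) : Prop := S m /\ lbound S m.

(* Greatest and least element; conventionally 0 when there is none. *)
Definition rmax (S : set R) : R := xget 0 (is_max S).
Definition rmin (S : set R) : R := xget 0 (is_min S).
End Extrema.

Section Notions.
Context {R : realType} {F : scalar_field R}.

Definition adjoint m n (A : 'M[F]_(m, n)) : 'M[F]_(n, m) :=
  map_mx (@sconj R F) A^T.

(* v^H v has zero imaginary part, so that taking [sre] loses nothing. *)
Definition norm2 n (v : 'cV[F]_n) : R :=
  Num.sqrt (sre ((adjoint v *m v) ord0 ord0)).

Definition unit_sphere n : set 'cV[F]_n := [set v | norm2 v = 1].

Definition spectral_norm n (A : 'M[F]_n) : R :=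
  rmax [set norm2 (A *m v) | v in @unit_sphere n].

Definition right_singular_vector n (A : 'M[F]_n) (s : R) (v : 'cV[F]_n) :
    Prop :=
  unit_sphere v /\
  exists u : 'cV[F]_n, [/\ unit_sphere u,
    A *m v = sreal F s *: u & adjoint A *m u = sreal F s *: v].

(* The linear span of a possibly infinite set of vectors. *)
Definition set_span (V : vectType F) (S : set V) : set V :=
  [set x | exists vs : seq V,
     (forall v, v \in vs -> S v) /\ x \in <<vs>>%VS].

Definition max_singular_span n (A : 'M[F]_n) : set 'cV[F]_n :=
  set_span (right_singular_vector A (spectral_norm A)).

(* The m-dimensional field; S is a set because it is used with [setT] and with
   a [set_span]. *)
Definition restricted_field m n (B : m.-tuple 'M[F]_n) (S : set 'cV[F]_n) :
    set 'cV[F]_m :=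
  [set (\col_(i < m) (adjoint v *m tnth B i *m v) ord0 ord0)
     | v in S `&` @unit_sphere n].

End Notions.

(* Main.v *)
Require Import Defs.
From HB Require Import structures.
From mathcomp Require Import all_boot all_order all_algebra.
From mathcomp Require Import all_classical all_reals.
From mathcomp Require Import complex.
From mathcomp Require Import ring lra.
Set Implicit Arguments.
Unset Strict Implicit.
Unset Printing Implicit Defensive.
Import Order.TTheory GRing.Theory Num.Theory.
Local Open Scope classical_set_scope.
Local Open Scope ring_scope.

(** Write [C = Y - Xs] and [s] for the spectral norm of [C].  Each of the three
    conditions says that there is a critical vector: a unit vector [v] at which
    [C] attains its norm, [|C v| = s], and whose image [C v] is orthogonal to
    [Z v] for all [Z] in the approximating space [XX].

    - Condition (1) ([minimax_eq_critical]).  The right-hand side of (1) is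
      [s].  If [v] is critical, then by Pythagoras [|(Y - Z) v| >= |C v| = s]
      for all [Z], so the inner minimum at [v] is [s]; at any unit [w] it is at
      most [|C w| <= s].  Conversely, a maximizer [v] with inner minimum [s]
      satisfies [s <= |(Y - Z) v|] for all [Z]; for [Z = Xs] this gives
      [|C v| = s], and then [Xs] is the best choice at [v], which forces [C v]
      to be orthogonal to [Z v] ([ortho_of_min]).
    - Condition (2) ([field_zero_critical]).  The coordinates of the field are
      [v^H C^H X_i v = (C v)^H (X_i v)], and by [max_singular_spanE] a unit
      vector lies in the span of the maximal right singular vectors exactly
      when [C] attains its norm there.
    - Condition (3) ([field_e1_critical]).  The first coordinate is
      [(C v)^H (C v + Xs v)], which is [|C v|^2] once the remaining coordinates
      vanish, because [Xs] lies in [XX].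

    What remains is that [C] attains its norm ([norm_attained]), and that a
    vector where it does is an eigenvector of [C^H C] for [s^2]
    ([gram_eigenvector]).  Both follow without any compactness argument from
    one inequality, [defect_bound]: if [|C v|^2 <= t |v|^2] for all [v], then
    the matrix [P = t - C^H C] satisfies [|P v|^2 <= (t + 1) (v^H P v)].  Hence
    [v^H P v = 0] implies [P v = 0].  Moreover, if [t] is the least such bound,
    then [P] is singular, since otherwise [v^H P v] would be bounded below by
    a positive multiple of [|v|^2] and [t] could be lowered; a unit vector in
    the kernel of [P] is then a maximizer.

    Everything but the orthogonality itself is expressed through the real part
    [rdot] of the Hermitian product, so that the real and the complex case
    share one proof once the elementary laws of the scalars are known. *)

(** * Laws common to the real and the complex scalars *)

Section ScalarLaws.
Context {R : realType} {F : scalar_field R}.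
Context (hF : F = real_scalars R \/ F = complex_scalars R).
Implicit Types (x y : F) (t : R).

Lemma sconjD x y : sconj (x + y) = sconj x + sconj y.
Proof. by move: x y; case: hF => -> x y //; exact: raddfD. Qed.

Lemma sconjM x y : sconj (x * y) = sconj x * sconj y.
Proof. by move: x y; case: hF => -> x y //; exact: rmorphM. Qed.

Lemma sconjK : involutive (@sconj R F).
Proof. by case: hF => -> // -[a b] /=; rewrite opprK. Qed.

Lemma sconj_real t : sconj (sreal F t) = sreal F t.
Proof. by case: hF => -> //=; rewrite oppr0. Qed.

Lemma sreD x y : sre (x + y) = sre x + sre y.
Proof. by move: x y; case: hF => -> // -[a b] [c d]. Qed.

Lemma sre_conj x : sre (sconj x) = sre x.
Proof. by move: x; case: hF => -> // -[a b]. Qed.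

Lemma sre_realM t x : sre (sreal F t * x) = t * sre x.
Proof. by move: x; case: hF => -> // -[a b] /=; rewrite mul0r subr0. Qed.

Lemma sreal1 : sreal F 1 = 1.
Proof. by case: hF => ->. Qed.

Lemma srealM t u : sreal F (t * u) = sreal F t * sreal F u.
Proof.
case: hF => -> //=; apply/eqP.
by rewrite eq_complex /= !(mulr0, mul0r) subr0 addr0 !eqxx.
Qed.

Lemma sconj_mul_self x : sconj x * x = sreal F (sre (sconj x * x)).
Proof.
move: x; case: hF => -> // -[a b]; apply/eqP.
by rewrite eq_complex /= eqxx mulNr mulrC subrr eqxx.
Qed.

Lemma sre_mul_self_ge0 x : 0 <= sre (sconj x * x).
Proof.
move: x; case: hF => -> x; first exact: sqr_ge0.
by case: x => a b /=; rewrite mulNr opprK addr_ge0 // -expr2 sqr_ge0.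
Qed.

Lemma sre_mul_self_eq0 x : sre (sconj x * x) = 0 -> x = 0.
Proof.
move: x; case: hF => -> x /=; first by move/eqP; rewrite mulf_eq0 orbb => /eqP.
case: x => a b /=; rewrite mulNr opprK => /eqP.
rewrite paddr_eq0 -?expr2 ?sqr_ge0 // !sqrf_eq0.
by move=> /andP[/eqP -> /eqP ->].
Qed.

Lemma sconj0 : sconj (0 : F) = 0.
Proof. by apply: (addrI (sconj 0)); rewrite -sconjD !addr0. Qed.

Lemma sre0 : sre (0 : F) = 0.
Proof. by apply: (addrI (sre (0 : F))); rewrite -sreD !addr0. Qed.

Lemma sreal_sre t : sre (sreal F t) = t.
Proof. by case: hF => ->. Qed.

Lemma sconj_sum (I : Type) (r : seq I) (P : pred I) (f : I -> F) :
  sconj (\sum_(i <- r | P i) f i) = \sum_(i <- r | P i) sconj (f i).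
Proof. by apply: big_morph; [exact: sconjD | exact: sconj0]. Qed.

Lemma sre_sum (I : Type) (r : seq I) (P : pred I) (f : I -> F) :
  sre (\sum_(i <- r | P i) f i) = \sum_(i <- r | P i) sre (f i).
Proof. by apply: big_morph; [exact: sreD | exact: sre0]. Qed.

Lemma srealD t u : sreal F (t + u) = sreal F t + sreal F u.
Proof. by case: hF => -> //=; apply/eqP; rewrite eq_complex /= addr0 !eqxx. Qed.

Lemma sreal0 : sreal F 0 = 0.
Proof. by case: hF => ->. Qed.

Lemma sreal_sum (I : Type) (r : seq I) (P : pred I) (f : I -> R) :
  sreal F (\sum_(i <- r | P i) f i) = \sum_(i <- r | P i) sreal F (f i).
Proof. by apply: big_morph; [exact: srealD | exact: sreal0]. Qed.

Lemma adjointK m n : cancel (@adjoint R F m n) (@adjoint R F n m).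
Proof. by move=> A; apply/matrixP => i j; rewrite !mxE sconjK. Qed.

Lemma adjointM m n p (A : 'M[F]_(m, n)) (B : 'M[F]_(n, p)) :
  adjoint (A *m B) = adjoint B *m adjoint A.
Proof.
apply/matrixP => i j; rewrite !mxE sconj_sum; apply: eq_bigr => l _.
by rewrite sconjM !mxE mulrC.
Qed.

(** * The Hermitian product and its real part *)

Definition hdot n (u v : 'cV[F]_n) : F := (adjoint u *m v) ord0 ord0.
Definition rdot n (u v : 'cV[F]_n) : R := sre (hdot u v).
Definition sqnorm n (v : 'cV[F]_n) : R := rdot v v.

Section Dot.
Context {n : nat}.
Implicit Types (u v w : 'cV[F]_n).

Lemma hdot_conj u v : hdot u v = sconj (hdot v u).
Proof. by rewrite /hdot -[v in LHS]adjointK -adjointM !mxE. Qed.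

Lemma hdotDr u v w : hdot u (v + w) = hdot u v + hdot u w.
Proof. by rewrite /hdot mulmxDr mxE. Qed.

Lemma hdotZr u a v : hdot u (a *: v) = a * hdot u v.
Proof. by rewrite /hdot -scalemxAr mxE. Qed.

Lemma hdot0r u : hdot u 0 = 0.
Proof. by rewrite /hdot mulmx0 mxE. Qed.

Lemma rdotC u v : rdot u v = rdot v u.
Proof. by rewrite /rdot hdot_conj sre_conj. Qed.

Lemma rdotDr u v w : rdot u (v + w) = rdot u v + rdot u w.
Proof. by rewrite /rdot hdotDr sreD. Qed.

Lemma rdotDl u v w : rdot (v + w) u = rdot v u + rdot w u.
Proof. by rewrite ![rdot _ u]rdotC rdotDr. Qed.

Lemma rdotZr u t v : rdot u (sreal F t *: v) = t * rdot u v.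
Proof. by rewrite /rdot hdotZr sre_realM. Qed.

Lemma rdotZl u t v : rdot (sreal F t *: v) u = t * rdot v u.
Proof. by rewrite ![rdot _ u]rdotC rdotZr. Qed.

Lemma sqnormE v : sqnorm v = \sum_i sre (sconj (v i ord0) * v i ord0).
Proof.
by rewrite /sqnorm /rdot /hdot mxE sre_sum; apply: eq_bigr => i _; rewrite !mxE.
Qed.

Lemma sqnorm_ge0 v : 0 <= sqnorm v.
Proof. by rewrite sqnormE sumr_ge0 // => i _; apply: sre_mul_self_ge0. Qed.

Lemma sqnorm_eq0 v : sqnorm v = 0 -> v = 0.
Proof.
rewrite sqnormE => /eqP; rewrite psumr_eq0; last first.
  by move=> i _; apply: sre_mul_self_ge0.
move/allP => v0; apply/matrixP => i j; rewrite ord1 mxE.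
by apply/sre_mul_self_eq0/eqP/v0; rewrite mem_index_enum.
Qed.

Lemma sqnorm0 : sqnorm (0 : 'cV[F]_n) = 0.
Proof. by rewrite /sqnorm /rdot hdot0r sre0. Qed.

Lemma hdot_self v : hdot v v = sreal F (sqnorm v).
Proof.
rewrite sqnormE sreal_sum /hdot mxE.
by apply: eq_bigr => i _; rewrite !mxE; exact: sconj_mul_self.
Qed.

Lemma sqnormDZ v w t :
  sqnorm (v + sreal F t *: w) =
  sqnorm v + 2 * t * rdot v w + t ^+ 2 * sqnorm w.
Proof.
rewrite /sqnorm rdotDr !rdotDl !rdotZr !rdotZl [rdot w v]rdotC.
ring.
Qed.

Lemma sqnormZ a v : sqnorm (a *: v) = sre (sconj a * a) * sqnorm v.
Proof.
rewrite !sqnormE mulr_sumr; apply: eq_bigr => i _; rewrite !mxE sconjM.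
by rewrite mulrACA [sconj a * a]sconj_mul_self sre_realM sreal_sre.
Qed.

Lemma unit_sphereE v : unit_sphere v <-> sqnorm v = 1.
Proof.
rewrite /unit_sphere /= /norm2 -/(hdot v v) -/(rdot v v) -/(sqnorm v).
split=> [nv1|->]; last exact: sqrtr1.
by rewrite -[LHS]sqr_sqrtr ?sqnorm_ge0 // nv1 expr1n.
Qed.

Lemma norm2E v : norm2 v = Num.sqrt (sqnorm v). Proof. by []. Qed.

Lemma exists_unit_multiple v : v != 0 -> exists a, sqnorm (a *: v) = 1.
Proof.
move=> v0; have nv0 : 0 < sqnorm v.
  rewrite lt_neqAle sqnorm_ge0 andbT eq_sym.
  by apply: contra_neq v0; apply: sqnorm_eq0.
exists (sreal F (Num.sqrt (sqnorm v))^-1); rewrite sqnormZ sconj_real sre_realM.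
rewrite sreal_sre -expr2 exprVn sqr_sqrtr ?ltW // mulVf //.
by rewrite gt_eqF.
Qed.

(** First-order condition for a minimum along the line [u + F v]: otherwise
    subtracting from [u] its projection on [v] would shorten it. *)
Lemma ortho_of_min u v :
  (forall a, sqnorm u <= sqnorm (u + a *: v)) -> hdot u v = 0.
Proof.
(* [rdot u w] is the squared modulus of [b], so a real step along [w] reaches
   the projection also when the scalars are complex. *)
move=> umin; set b := hdot u v; pose w := sconj b *: v.
have uw : rdot u w = sre (sconj b * b) by rewrite /rdot hdotZr.
have [w0|w0] := eqVneq (sqnorm w) 0.
  by apply: sre_mul_self_eq0; rewrite -uw (sqnorm_eq0 w0) /rdot hdot0r sre0.
apply: sre_mul_self_eq0; rewrite -uw; apply/eqP; rewrite -sqrf_eq0; apply/eqP.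
have nw : 0 < sqnorm w by rewrite lt_neqAle eq_sym w0 sqnorm_ge0.
have := umin (sreal F (- (rdot u w / sqnorm w)) * sconj b).
rewrite -scalerA sqnormDZ -/w -subr_ge0.
have -> : sqnorm u + 2 * - (rdot u w / sqnorm w) * rdot u w +
  (- (rdot u w / sqnorm w)) ^+ 2 * sqnorm w - sqnorm u =
  - (rdot u w ^+ 2 / sqnorm w) by field.
rewrite oppr_ge0 pmulr_lle0 ?invr_gt0 // => le0.
by apply/eqP; rewrite eq_le le0 sqr_ge0.
Qed.

End Dot.

Lemma rdot_adjoint m n (A : 'M[F]_(m, n)) u v :
  rdot (adjoint A *m u) v = rdot u (A *m v).
Proof. by rewrite /rdot /hdot adjointM adjointK mulmxA. Qed.

(** * Attainment of the spectral norm *)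

(** Boundedness is stable under sums and holds for the multiples of the matrix
    units. *)
Lemma bounded_mx m n (A : 'M[F]_(m, n)) :
  exists L : R, forall v, sqnorm (A *m v) <= L * sqnorm v.
Proof.
rewrite (matrix_sum_delta A).
pose bounded (B : 'M[F]_(m, n)) :=
  exists L : R, forall v, sqnorm (B *m v) <= L * sqnorm v.
have bounded0 : bounded 0.
  by exists 0 => v; rewrite mul0mx sqnorm0 mul0r.
have boundedD B D : bounded B -> bounded D -> bounded (B + D).
  move=> [K BK] [L DL]; exists (2 * K + 2 * L) => v.
  have := sqnorm_ge0 (B *m v + sreal F (-1) *: (D *m v)).
  have := sqnormDZ (B *m v) (D *m v) 1; rewrite sreal1 scale1r sqnormDZ.
  rewrite mulmxDl => ->; have := BK v; have := DL v; lra.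
apply: (big_ind bounded) => // i _; apply: (big_ind bounded) => // j _.
exists (sre (sconj (A i j) * A i j)) => v.
rewrite -scalemxAl sqnormZ ler_wpM2l ?sre_mul_self_ge0 //.
have -> : delta_mx i j *m v = (v j ord0) *: delta_mx i ord0.
  rewrite -[v in LHS]mul1mx; apply/matrixP => p q; rewrite ord1 mul1mx !mxE.
  rewrite (bigD1 j) //= big1 ?addr0 => [|l /negPf lj]; rewrite !mxE ?eqxx ?lj.
    by rewrite andbT mulrC.
  by rewrite andbF mul0r.
have nd1 : sqnorm (delta_mx i ord0 : 'cV[F]_m) = 1.
  rewrite sqnormE (bigD1 i) //= big1 ?addr0 => [|l /negPf li].
    rewrite mxE !eqxx mulr1 -sreal1 sconj_real.
    by rewrite sreal_sre.
  by rewrite mxE li mulr0 sre0.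
rewrite sqnormZ nd1 mulr1 sqnormE (bigD1 j) //= lerDl.
by rewrite sumr_ge0 // => l _; apply: sre_mul_self_ge0.
Qed.

(** With [P = s - C^H C], the quadratic form [q w = w^H P w] is nonnegative and
    at most [(s + 1) |w|^2].  Evaluating it at [v - P v / (s + 1)] gives
    [0 <= q v - |P v|^2 / (s + 1)], a quantitative form of the fact that a
    zero of a positive semidefinite form lies in its kernel.  Using [s + 1]
    instead of [s] avoids a division by zero when [s = 0]. *)
Lemma defect_bound m n (C : 'M[F]_(m, n)) s :
  0 <= s -> (forall v, sqnorm (C *m v) <= s * sqnorm v) ->
  forall v, sqnorm (sreal F s *: v - adjoint C *m (C *m v)) <=
            (s + 1) * (s * sqnorm v - sqnorm (C *m v)).
Proof.
move=> s0 Cs v; set w := _ - _; pose t := - (s + 1)^-1.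
have s1 : 0 < s + 1 by rewrite ltr_wpDl.
have ww : sqnorm w = s * rdot v w - rdot (C *m v) (C *m w).
  rewrite /sqnorm {1}/w rdotDl rdotZl -scaleN1r.
  have -> : (-1 : F) = sreal F (-1).
    by apply/esym/eqP; rewrite -addr_eq0 -sreal1 -srealD addNr sreal0.
  by rewrite rdotZl rdot_adjoint mulN1r.
have := Cs (v + sreal F t *: w); rewrite mulmxDr -scalemxAr !sqnormDZ.
rewrite -subr_ge0.
have -> : s * (sqnorm v + 2 * t * rdot v w + t ^+ 2 * sqnorm w) -
   (sqnorm (C *m v) + 2 * t * rdot (C *m v) (C *m w) +
    t ^+ 2 * sqnorm (C *m w)) =
   (s * sqnorm v - sqnorm (C *m v)) + 2 * t * sqnorm w +
   t ^+ 2 * (s * sqnorm w - sqnorm (C *m w)) by rewrite ww; ring.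
have : t ^+ 2 * (s * sqnorm w - sqnorm (C *m w)) <= - t * sqnorm w.
  have -> : - t * sqnorm w = t ^+ 2 * ((s + 1) * sqnorm w).
    by rewrite /t; field; rewrite gt_eqF.
  rewrite ler_wpM2l ?sqr_ge0 // mulrDl mul1r lerD2l.
  by rewrite (le_trans _ (sqnorm_ge0 w)) // oppr_le0 sqnorm_ge0.
move=> le1 ge0; rewrite -ler_pdivrMl // -[_^-1]opprK -/t; lra.
Qed.

(** The infimum [s] of the bounds is itself a bound, and [s - C^H C] cannot be
    invertible, for then [defect_bound] would make a smaller number a bound. *)
Lemma norm_attained n (C : 'M[F]_n) : (0 < n)%N ->
  exists s v, [/\ sqnorm v = 1, sqnorm (C *m v) = s &
    forall w, sqnorm (C *m w) <= s * sqnorm w].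
Proof.
move=> n0; pose T : set R :=
  [set t | forall w, sqnorm (C *m w) <= t * sqnorm w].
have [e ne1] : exists e : 'cV[F]_n, sqnorm e = 1.
  have [|a na1] := @exists_unit_multiple n (const_mx 1).
    apply/eqP => /matrixP/(_ (Ordinal n0) ord0)/eqP.
    by rewrite !mxE oner_eq0.
  by exists (a *: const_mx 1).
have T_ge0 t : T t -> 0 <= t.
  by move=> /(_ e); rewrite ne1 mulr1; apply: le_trans; exact: sqnorm_ge0.
have hlb : has_lbound T by exists 0 => t; exact: T_ge0.
have T0 : T !=set0 by have [L CL] := bounded_mx C; exists L.
pose s := inf T.
have Ts : T s.
  move=> w; have [w0|w0] := eqVneq w 0.
    by rewrite w0 mulmx0 !sqnorm0 mulr0.
  have nw : 0 < sqnorm w.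
    rewrite lt_neqAle sqnorm_ge0 andbT eq_sym.
    by apply: contra_neq w0; apply: sqnorm_eq0.
  rewrite -ler_pdivrMr //; apply: lb_le_inf => // t Tt.
  by rewrite ler_pdivrMr.
have s0 := T_ge0 _ Ts.
pose P : 'M[F]_n := (sreal F s)%:M - adjoint C *m C.
have PE v : P *m v = sreal F s *: v - adjoint C *m (C *m v).
  by rewrite mulmxBl mul_scalar_mx mulmxA.
have Pbound v : sqnorm (P *m v) <= (s + 1) * (s * sqnorm v - sqnorm (C *m v)).
  by rewrite PE; exact: defect_bound.
have : \det P == 0.
  apply: contraT => detP; have uP : P \in unitmx by rewrite unitmxE unitfE.
  have [L PL] := bounded_mx (invmx P).
  (* e is the image of P e under the inverse, so that bound cannot be null *)
  have L0 : 0 < L.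
    have := PL (P *m e); rewrite mulKmx // ne1.
    by have := sqnorm_ge0 (P *m e); nra.
  have k0 : 0 < L * (s + 1) by rewrite mulr_gt0 // ltr_wpDl.
  (* |w|^2 <= L |P w|^2 <= L (s + 1) (s |w|^2 - |C w|^2) *)
  have : T (s - (L * (s + 1))^-1).
    move=> w; rewrite mulrBl lerBrDl -lerBrDr ler_pdivrMl // -mulrA.
    rewrite -{1}(mulKmx uP w); apply: le_trans (PL _) _.
    by rewrite ler_wpM2l // ltW.
  move/(ge_inf hlb); rewrite -/s lerBrDl gerDr.
  by rewrite invr_le0 leNgt k0.
rewrite -det_tr => /det0P[u u0 uP0].
have Pu : P *m u^T = 0 by rewrite -[P]trmxK -trmx_mul uP0 trmx0.
have [|a na] := @exists_unit_multiple n u^T.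
  by apply: contra_neq u0 => /(congr1 trmx); rewrite trmxK trmx0.
exists s, (a *: u^T); split=> //.
have : P *m (a *: u^T) = 0 by rewrite -scalemxAr Pu scaler0.
rewrite PE => /eqP; rewrite subr_eq0 => /eqP vE.
rewrite /sqnorm -rdot_adjoint -vE rdotZl.
by rewrite -/(sqnorm _) na mulr1.
Qed.

End ScalarLaws.

(** * Spans, greatest and least elements *)

Lemma span_ind (K : fieldType) (V : vectType K) (P : V -> Prop) (vs : seq V) :
  P 0 -> (forall x y, P x -> P y -> P (x + y)) ->
  (forall a x, P x -> P (a *: x)) -> (forall x, x \in vs -> P x) ->
  forall x, x \in <<vs>>%VS -> P x.
Proof.
move=> P0 PD PZ Pvs x /(coord_span (X := in_tuple vs)) ->.
by apply: big_ind => // i _; apply/PZ/Pvs/mem_nth.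
Qed.

Lemma rmaxE (R : realType) (S : set R) m : is_max S m -> rmax S = m.
Proof.
move=> mS; apply: xget_unique => // y [Sy uy]; case: mS => Sm um.
by apply/eqP; rewrite eq_le um // uy.
Qed.

Lemma rminE (R : realType) (S : set R) m : is_min S m -> rmin S = m.
Proof.
move=> mS; apply: xget_unique => // y [Sy uy]; case: mS => Sm um.
by apply/eqP; rewrite eq_le um // uy.
Qed.

(** Since [rmax] falls back to 0 when there is no greatest element, a nonzero
    value certifies that the maximum is attained. *)
Lemma rmax_neq0 (R : realType) (S : set R) : rmax S != 0 -> is_max S (rmax S).
Proof. by rewrite /rmax; case: xgetP => [y -> //|_]; rewrite eqxx. Qed.

Lemma rmin_cases (R : realType) (S : set R) :
  rmin S = 0 \/ is_min S (rmin S).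
Proof. by rewrite /rmin; case: xgetP => [y ->|]; [right|left]. Qed.

(** * Maximal right singular vectors *)

Section Spectral.
Context {R : realType} {F : scalar_field R}.
Context (hF : F = real_scalars R \/ F = complex_scalars R).
Context {n : nat} (C : 'M[F]_n).
Context (n_gt0 : (0 < n)%N).

Lemma spectral_normP :
  0 <= spectral_norm C /\
  forall v, sqnorm (C *m v) <= spectral_norm C ^+ 2 * sqnorm v.
Proof.
have [s [v [nv Cv Cs]]] := norm_attained hF C n_gt0.
have s0 : 0 <= s by rewrite -Cv sqnorm_ge0.
suff -> : spectral_norm C = Num.sqrt s by rewrite sqrtr_ge0 sqr_sqrtr.
apply: rmaxE; split=> [|_ [w /(unit_sphereE hF) nw <-]].
  by exists v; [apply/unit_sphereE | rewrite norm2E Cv].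
by rewrite norm2E ler_wsqrtr //; have := Cs w; rewrite nw mulr1.
Qed.

(** The right-hand side of [defect_bound] vanishes at such a [v]. *)
Lemma gram_eigenvector v :
  sqnorm (C *m v) = spectral_norm C ^+ 2 * sqnorm v ->
  adjoint C *m (C *m v) = sreal F (spectral_norm C ^+ 2) *: v.
Proof.
move=> Cv; have [_ Cs] := spectral_normP.
have := defect_bound hF (sqr_ge0 _) Cs v; rewrite Cv subrr mulr0 => le0.
apply/esym/eqP; rewrite -subr_eq0; apply/eqP/(sqnorm_eq0 hF).
by apply/eqP; rewrite eq_le le0 sqnorm_ge0.
Qed.

Lemma sqnorm_gram v :
  adjoint C *m (C *m v) = sreal F (spectral_norm C ^+ 2) *: v ->
  sqnorm (C *m v) = spectral_norm C ^+ 2 * sqnorm v.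
Proof. by move=> Cv; rewrite /sqnorm -(rdot_adjoint hF) Cv (rdotZl hF). Qed.

(** Maximal right singular vectors are eigenvectors of [C^H C] for the square
    of the norm; that property passes to their span and implies that the norm
    is attained.  Conversely, a unit vector where the norm is attained is
    itself a right singular vector, with left singular vector [C v / s]. *)
Lemma max_singular_spanE v : spectral_norm C != 0 -> sqnorm v = 1 ->
  max_singular_span C v <-> sqnorm (C *m v) = spectral_norm C ^+ 2.
Proof.
have [s_ge0 _] := spectral_normP; have eig := gram_eigenvector.
have sq := sqnorm_gram; move: s_ge0 eig sq; set s := spectral_norm C.
move=> s_ge0 eig sq s0 nv; split.
  move=> [vs [vsP vvs]]; rewrite (sq v) ?nv ?mulr1 //.
  pose eigenvector (w : 'cV[F]_n) :=
    adjoint C *m (C *m w) = sreal F (s ^+ 2) *: w.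
  apply: (span_ind (P := eigenvector)) vvs; rewrite /eigenvector.
  - by rewrite !mulmx0 scaler0.
  - by move=> x y Px Py; rewrite !mulmxDr Px Py scalerDr.
  - by move=> a x Px; rewrite -!scalemxAr Px !scalerA mulrC.
  - move=> w /vsP[_ [u [_ -> Cu]]].
    by rewrite -scalemxAr Cu scalerA -(srealM hF) -expr2.
move=> Cv; exists [:: v]; split; last by rewrite memv_span ?mem_head.
move=> w; rewrite inE => /eqP ->{w}; split; first exact/unit_sphereE.
have ss : sreal F s * sreal F s^-1 = 1 by rewrite -srealM // divff // sreal1.
exists (sreal F s^-1 *: (C *m v)); split.
- apply/unit_sphereE => //; rewrite sqnormZ // sconj_real // sre_realM //.
  by rewrite sreal_sre // Cv; field.
- by rewrite scalerA ss scale1r.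
- rewrite -scalemxAr eig; last by rewrite nv mulr1.
  by rewrite scalerA -srealM //; congr (sreal F _ *: v); rewrite -/s; field.
Qed.

End Spectral.

(** * Critical vectors and the three conditions *)

Section Saddle.
Context {R : realType} {F : scalar_field R}.
Context (hF : F = real_scalars R \/ F = complex_scalars R).
Context {n : nat} (XX : {vspace 'M[F]_n}) (Y Xs : 'M[F]_n).
Context (hY : Y \notin XX) (hXs : Xs \in XX).
Context (hmin : is_min [set spectral_norm (Y - Z) | Z in [set` XX]]
                       (spectral_norm (Y - Xs))).

Let C : 'M[F]_n := Y - Xs.
Let s := spectral_norm C.

(** The common content of the three conditions: [v] attains the norm of the
    residual matrix, and the residual [C v] cannot be shortened within
    [XX v]. *)
Definition critical_vector (v : 'cV[F]_n) : Prop :=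
  [/\ sqnorm v = 1, sqnorm (C *m v) = s ^+ 2 &
      forall Z, Z \in XX -> hdot (C *m v) (Z *m v) = 0].

(** In dimension 0 the only matrix is 0, which lies in every subspace. *)
Lemma dim_gt0 : (0 < n)%N.
Proof.
rewrite lt0n; apply: contra hY => /eqP n0.
suff -> : Y = 0 by exact: mem0v.
by apply/matrixP => -[i i_lt]; exfalso; rewrite n0 in i_lt.
Qed.

(** Since [Y] is not in [XX], the residual matrix is nonzero. *)
Lemma residual_norm_gt0 : 0 < s.
Proof.
have [s0 Cs] := spectral_normP hF C dim_gt0.
rewrite lt_neqAle s0 andbT; apply: contra hY => /eqP sE.
suff C0 : C = 0 by rewrite -(subrK Xs Y) -/C C0 add0r.
apply/matrixP => i j; rewrite [RHS]mxE.
have /(sqnorm_eq0 hF)/matrixP/(_ i ord0) : sqnorm (C *m delta_mx j ord0) = 0.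
  apply/eqP; rewrite eq_le sqnorm_ge0 // andbT.
  by apply: le_trans (Cs _) _; rewrite -/s -sE expr0n mul0r.
by rewrite -colE !mxE.
Qed.

Lemma minmaxE :
  rmin [set rmax [set norm2 ((Y - Z) *m v) | v in @unit_sphere R F n]
       | Z in [set` XX]] = s.
Proof. exact: rminE hmin. Qed.

Lemma residual_le v : unit_sphere v -> norm2 (C *m v) <= s.
Proof.
move=> /(unit_sphereE hF) nv; have [s0 Cs] := spectral_normP hF C dim_gt0.
by rewrite norm2E -[s]ger0_norm // -sqrtr_sqr ler_wsqrtr // -[_ ^+ 2]mulr1 -nv.
Qed.

(** Pythagoras: [(Y - Z) v = C v + (Xs - Z) v] with orthogonal summands. *)
Lemma critical_min v : critical_vector v ->
  is_min [set norm2 ((Y - Z) *m v) | Z in [set` XX]] s.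
Proof.
move=> [nv Cv orth]; have s0 := ltW residual_norm_gt0.
split; first by exists Xs => //; rewrite norm2E -/C Cv sqrtr_sqr ger0_norm.
move=> _ [Z ZX <-]; rewrite norm2E -[s]ger0_norm // -sqrtr_sqr ler_wsqrtr //.
have -> : (Y - Z) *m v = C *m v + sreal F 1 *: ((Xs - Z) *m v).
  by rewrite sreal1 // scale1r -mulmxDl addrA subrK.
rewrite sqnormDZ // Cv /rdot orth ?rpredB // sre0 // mulr0 addr0 lerDl.
by rewrite mulr_ge0 ?sqr_ge0 ?sqnorm_ge0.
Qed.

(** A critical vector is a maximizer because at any other unit vector the inner
    minimum is at most [s], whether it is attained or replaced by its default
    value 0.  In the other direction [s > 0] excludes the default values. *)
Lemma minimax_eq_critical :
  rmax [set rmin [set norm2 ((Y - Z) *m v) | Z in [set` XX]]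
       | v in @unit_sphere R F n] = s <-> exists v, critical_vector v.
Proof.
have s_gt0 := residual_norm_gt0; split.
  move=> maxE; have : rmax [set rmin [set norm2 ((Y - Z) *m v) | Z in [set` XX]]
       | v in @unit_sphere R F n] != 0 by rewrite maxE gt_eqF.
  move=> /rmax_neq0[]; rewrite maxE => -[v uv minE] _; exists v.
  have [|] := rmin_cases [set norm2 ((Y - Z) *m v) | Z in [set` XX]].
    by rewrite minE => s0; move: s_gt0; rewrite s0 ltxx.
  rewrite minE => -[_ lb].
  have Cv : norm2 (C *m v) = s.
    by apply/eqP; rewrite eq_le residual_le //=; apply: lb; exists Xs.
  have nCv : sqnorm (C *m v) = s ^+ 2.
    by rewrite -Cv norm2E sqr_sqrtr // sqnorm_ge0.
  split=> // [|Z ZX]; first exact/unit_sphereE.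
  apply: ortho_of_min => // a; rewrite nCv.
  have -> : C *m v + a *: (Z *m v) = (Y - (Xs - a *: Z)) *m v.
    by rewrite scalemxAl -mulmxDl opprB addrCA addrC.
  rewrite -[leRHS]sqr_sqrtr ?sqnorm_ge0 // -norm2E.
  rewrite ler_sqr ?nnegrE ?(ltW s_gt0) ?sqrtr_ge0 //.
  by apply: lb; exists (Xs - a *: Z) => //=; rewrite rpredB ?rpredZ.
move=> [v cv]; have uv : unit_sphere v by apply/unit_sphereE => //; case: cv.
apply: rmaxE; split; first by exists v => //; apply/rminE/critical_min.
move=> _ [w uw <-].
have [->|[_ lb]] := rmin_cases [set norm2 ((Y - Z) *m w) | Z in [set` XX]].
  exact: ltW.
by apply: le_trans (residual_le uw); apply: lb; exists Xs.
Qed.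

Section Field.
Context {k : nat} (X : k.-tuple 'M[F]_n) (hXX : XX = <<X>>%VS).

Let A := [tuple adjoint C *m tnth X i | i < k].

Lemma form_hdot (B : 'M[F]_n) v :
  (adjoint v *m (adjoint C *m B) *m v) ord0 ord0 = hdot (C *m v) (B *m v).
Proof. by rewrite /hdot adjointM // !mulmxA. Qed.

Lemma ortho_span v : (forall i, hdot (C *m v) (tnth X i *m v) = 0) ->
  forall Z, Z \in XX -> hdot (C *m v) (Z *m v) = 0.
Proof.
move=> orth Z; rewrite hXX.
apply: (span_ind (P := fun Z => hdot (C *m v) (Z *m v) = 0))
  => [|x y Px Py|a x Px|x].
- by rewrite mul0mx hdot0r.
- by rewrite [(x + y) *m v]mulmxDl hdotDr Px Py addr0.
- by rewrite -scalemxAl hdotZr Px mulr0.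
- by move=> /tnthP[i ->].
Qed.

Lemma tnth_mem_span i : tnth X i \in XX.
Proof. by rewrite hXX memv_span // mem_tnth. Qed.

(** The vanishing of the form of [C^H X_i] at [v] is the orthogonality of [C v]
    and [X_i v], and the [X_i] span [XX]. *)
Lemma field_zero_critical :
  restricted_field A (max_singular_span C) 0 <-> exists v, critical_vector v.
Proof.
have s0 : s != 0 by rewrite gt_eqF // residual_norm_gt0.
split=> [[v [Sv /(unit_sphereE hF) nv] /matrixP Av]|[v [nv Cv orth]]].
  exists v; split=> //; first exact/(max_singular_spanE hF dim_gt0 s0 nv).
  apply: ortho_span => i; have := Av i ord0.
  by rewrite [LHS]mxE [RHS]mxE tnth_mktuple form_hdot.
exists v; first split; try exact/unit_sphereE.
  exact/(max_singular_spanE hF dim_gt0 s0 nv).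
apply/matrixP => i j; rewrite [LHS]mxE [RHS]mxE tnth_mktuple form_hdot.
exact/orth/tnth_mem_span.
Qed.

(** Given the orthogonality, the coordinate of [C^H Y] reduces to [|C v|^2],
    which is [s^2] exactly when [C] attains its norm at [v]; membership in the
    singular span is thus encoded by the first coordinate. *)
Lemma field_e1_critical :
  restricted_field (cons_tuple (adjoint C *m Y) A) setT
    (sreal F (s ^+ 2) *: col ord0 1%:M) <-> exists v, critical_vector v.
Proof.
have split_Y v : (forall Z, Z \in XX -> hdot (C *m v) (Z *m v) = 0) ->
    hdot (C *m v) (Y *m v) = sreal F (sqnorm (C *m v)).
  move=> orth; have -> : Y *m v = C *m v + Xs *m v by rewrite -mulmxDl subrK.
  by rewrite hdotDr (orth Xs) // addr0 hdot_self.
split=> [[v [_ /(unit_sphereE hF) nv] /matrixP Av]|[v [nv Cv orth]]].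
  have orth : forall Z, Z \in XX -> hdot (C *m v) (Z *m v) = 0.
    apply: ortho_span => i; have := Av (lift ord0 i) ord0.
    by rewrite [LHS]mxE tnthS tnth_mktuple form_hdot !mxE /= mulr0.
  exists v; split=> //; have := Av ord0 ord0.
  rewrite [LHS]mxE tnth0 form_hdot split_Y // !mxE eqxx mulr1.
  by move/(congr1 (@sre R F)); rewrite !sreal_sre.
exists v; first by split=> //; exact/unit_sphereE.
apply/matrixP => i j; rewrite [LHS]mxE.
case: (unliftP ord0 i) => [l|] ->.
  rewrite tnthS tnth_mktuple form_hdot !mxE /= mulr0.
  exact/orth/tnth_mem_span.
by rewrite tnth0 form_hdot split_Y // Cv !mxE eqxx mulr1.
Qed.

End Field.
End Saddle.

Theorem theorem18 (R : realType) (F : scalar_field R)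
  (hF : F = real_scalars R \/ F = complex_scalars R)
  (n k : nat) (X : k.-tuple 'M[F]_n) (XX : {vspace 'M[F]_n})
  (hXX : XX = <<X>>%VS) (hdim : (\dim XX)%VS = k)
  (Y : 'M[F]_n) (hY : Y \notin XX)
  (Xs : 'M[F]_n) (hXs : Xs \in XX)
  (hmin : is_min [set spectral_norm (Y - Z) | Z in [set` XX]]
                 (spectral_norm (Y - Xs))) :
  let A := [tuple adjoint (Y - Xs) *m tnth X i | i < k] in
  let AY := adjoint (Y - Xs) *m Y in
  let rho := spectral_norm (Y - Xs) ^+ 2 in
  let e1 : 'cV[F]_(k.+1) := col ord0 1%:M in
  let maxmin :=
    rmax [set rmin [set norm2 ((Y - Z) *m v) | Z in [set` XX]]
         | v in @unit_sphere R F n] in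
  let minmax :=
    rmin [set rmax [set norm2 ((Y - Z) *m v) | v in @unit_sphere R F n]
         | Z in [set` XX]] in
  (maxmin = minmax <->
     restricted_field A (max_singular_span (Y - Xs)) 0) /\
  (restricted_field A (max_singular_span (Y - Xs)) 0 <->
     restricted_field (cons_tuple AY A) setT (sreal F rho *: e1)).
Proof.
move=> A AY rho e1 maxmin minmax.
have zeroE := field_zero_critical hF hY hXs hXX.
have e1E := field_e1_critical hF Y hXs hXX.
have maxE := minimax_eq_critical hF hY hXs.
split; last by rewrite zeroE e1E.
by rewrite zeroE -maxE // /minmax (minmaxE hmin).
Qed.
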